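(* Let $K$ be a commutative, idempotent, totally ordered semifield, let $E$ be a free $K$-module of finite dimension $n$, and let $F$ be a tropically free submodule of $E$. Then any two tropical bases of $F$ have the same cardinality.
   Context: A commutative idempotent semifield is a set $K$ with commutative associative operations $+$ and $\cdot$, with neutral elements $0\ne 1$, $\cdot$ distributive over $+$, $0$ absorbing, every nonzero element multiplicatively invertible, and $x+x=x$ for all $x$. It is ordered by $a\le b \iff a+b=b$; it is totally ordered if this order is total (so $a+b=\max(a,b)$). A free $K$-module of dimension $n$ is a module with a basis of $n$ elements, i.e. isomorphic to $K^n$. For modules $E,F$, $L(E,F)$ is the module of linear maps with pointwise operations, and $E^*=L(E,K)$. In a commutative monoid $(M,+,0)$, $x\perp y$ (orthogonal) means: $x+z=x$ and $y+z=y$ imply $z=0$. (For elements of a free $K$-module, or for linear maps between free modules of finite rank viewed as matrices, this means disjoint supports.) Write $x=x_1\bigoplus x_2$ if $x=x_1+x_2$ and $x_1\perp x_2$. For a linear map $f:E\to F$: a point $u\in E$ is singular for $f$ if there is a decomposition $f=f_1\bigoplus f_2$ in $L(E,F)$ with $f_1(u)=f_2(u)$; $Tker(f)$ is the set of singular points, and $f$ is regular if $Tker(f)=\{0\}$. A point $u\in E$ is *singular for $f$ if there is a decomposition $u=u_1\bigoplus u_2$ in $E$ with $f(u_1)=f(u_2)$; $Ker^*(f)$ is the set of such points. A family $(f_i)_{i\in I}$ in $E$ is regular if the linear map $K^{(I)}\to E$, $(\lambda_i)\mapsto\sum\lambda_i f_i$, is regular. The submodule weakly (or tropically) generated by $(f_i)$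 is the intersection of the $Ker^* l$ over all $l\in E^*$ such that every element of $\sum_i Kf_i$ lies in $Ker^* l$. The family is weakly generating for a submodule $F$ of $E$ if $F$ is equal to this intersection. A tropical basis of a submodule $F$ is a regular family that is weakly generating for $F$. A submodule is tropically free if it admits a tropical basis. *)

(* Defs.v *)
From HB Require Import structures.
From mathcomp Require Import all_boot all_order all_algebra.
From mathcomp Require Import mathcomp_extra boolp classical_sets functions.
From mathcomp Require Import cardinality fsbigop.

Set Implicit Arguments.
Unset Strict Implicit.
Unset Printing Implicit Defensive.

Import GRing.Theory.

Local Open Scope classical_set_scope.
Local Open Scope ring_scope.

(* Commutativity, distributivity, absorption of 0 and 0 != 1 are part of the
   structure [comNzSemiRingType]. *)
Record idempotent_semifield (K : comNzSemiRingType) : Prop :=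
  IdempotentSemifield {
    semifield_inv : forall x : K, x != 0 -> exists y : K, x * y = 1;
    semifield_idem : forall x : K, x + x = x
  }.

Definition sle (K : comNzSemiRingType) (x y : K) : Prop := x + y = y.

Definition totally_ordered (K : comNzSemiRingType) : Prop :=
  forall x y : K, sle x y \/ sle y x.

Definition orthogonal (M : nmodType) (x y : M) : Prop :=
  forall z : M, x + z = x -> y + z = y -> z = 0.

Definition orth_decomp (M : nmodType) (x x1 x2 : M) : Prop :=
  x = x1 + x2 /\ orthogonal x1 x2.

(* L(U, V) as a commutative monoid, with pointwise operations. *)
Section LinearMaps.
Variables (K : comNzSemiRingType) (U V : lSemiModType K).
Implicit Types f g h : {linear U -> V}.

HB.instance Definition _ := gen_eqMixin {linear U -> V}.
HB.instance Definition _ := gen_choiceMixin {linear U -> V}.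

Lemma linear_ext f g : f =1 g -> f = g.
Proof.
case: f g => [f [[[f0 fD]] [fZ]]] [g [[[g0 gD]] [gZ]]] fg.
have {fg} efg : f = g by apply: funext => x; exact: fg x.
case: g / efg g0 gD gZ => g0 gD gZ.
rewrite (Prop_irrelevance g0 f0) (Prop_irrelevance gD fD).
by rewrite (Prop_irrelevance gZ fZ).
Qed.

Definition linear_zero : {linear U -> V} := \0.
Definition linear_add f g : {linear U -> V} := f \+ g.

Lemma linear_addA : associative linear_add.
Proof. by move=> f g h; apply: linear_ext => x /=; rewrite addrA. Qed.
Lemma linear_addC : commutative linear_add.
Proof. by move=> f g; apply: linear_ext => x /=; rewrite addrC. Qed.
Lemma linear_add0 : left_id linear_zero linear_add.
Proof. by move=> f; apply: linear_ext => x /=; rewrite add0r. Qed.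

HB.instance Definition _ := GRing.isNmodule.Build {linear U -> V}
  linear_addA linear_addC linear_add0.
End LinearMaps.

(* K^(I): families of scalars indexed by I with finite support. *)
Section FreeModule.
Variables (K : comNzSemiRingType) (I : choiceType).

Definition supp (c : I -> K) : set I := [set i | c i != 0].

Record free_module := FreeModule {
  coord_of :> I -> K;
  coord_finite : finite_set (supp coord_of)
}.

Implicit Types c d e : free_module.

HB.instance Definition _ := gen_eqMixin free_module.
HB.instance Definition _ := gen_choiceMixin free_module.

Lemma free_module_ext c d : c =1 d -> c = d.
Proof.
case: c d => [c hc] [d hd] /= /funext cd.
by case: d / cd hd => hd; rewrite (Prop_irrelevance hd hc).
Qed.

Lemma fm_zero_finite : finite_set (supp (fun=> 0)).
Proof.
rewrite (_ : supp _ = set0); first exact: finite_set0.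
by rewrite -subset0 => i; rewrite /supp /= eqxx.
Qed.

Lemma fm_add_finite c d : finite_set (supp (fun i => c i + d i)).
Proof.
apply: (@sub_finite_set _ _ (supp c `|` supp d)); last first.
  by rewrite finite_setU; split; exact: coord_finite.
move=> i; rewrite /supp /=; have [->|] := eqVneq (c i) 0; last by left.
by rewrite add0r; right.
Qed.

Lemma fm_scale_finite a c : finite_set (supp (fun i => a * c i)).
Proof.
apply: (@sub_finite_set _ _ (supp c)); last exact: coord_finite.
by move=> i; rewrite /supp /=; apply: contra_neq => ->; rewrite mulr0.
Qed.

Definition fm_zero := FreeModule fm_zero_finite.
Definition fm_add c d := FreeModule (fm_add_finite c d).
Definition fm_scale a c := FreeModule (fm_scale_finite a c).

Lemma fm_addA : associative fm_add.
Proof. by move=> c d e; apply: free_module_ext => i /=; rewrite addrA. Qed.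
Lemma fm_addC : commutative fm_add.
Proof. by move=> c d; apply: free_module_ext => i /=; rewrite addrC. Qed.
Lemma fm_add0 : left_id fm_zero fm_add.
Proof. by move=> c; apply: free_module_ext => i /=; rewrite add0r. Qed.

HB.instance Definition _ := GRing.isNmodule.Build free_module
  fm_addA fm_addC fm_add0.

Lemma fm_scaleA a b c : fm_scale a (fm_scale b c) = fm_scale (a * b) c.
Proof. by apply: free_module_ext => i /=; rewrite mulrA. Qed.
Lemma fm_scale0 c : fm_scale 0 c = 0.
Proof. by apply: free_module_ext => i /=; rewrite mul0r. Qed.
Lemma fm_scale1 : left_id 1 fm_scale.
Proof. by move=> c; apply: free_module_ext => i /=; rewrite mul1r. Qed.
Lemma fm_scaleDr : right_distributive fm_scale +%R.
Proof. by move=> a c d; apply: free_module_ext => i /=; rewrite mulrDr. Qed.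
Lemma fm_scaleDl c : {morph fm_scale^~ c : a b / a + b}.
Proof. by move=> a b; apply: free_module_ext => i /=; rewrite mulrDl. Qed.

HB.instance Definition _ := GRing.Nmodule_isLSemiModule.Build K free_module
  fm_scaleA fm_scale0 fm_scale1 fm_scaleDr fm_scaleDl.
End FreeModule.

Section LinearCombination.
Variables (K : comNzSemiRingType) (I : choiceType) (E : lSemiModType K).
Variable f : I -> E.

Definition lincomb (c : free_module K I) : E := \sum_(i \in supp c) c i *: f i.

Lemma lincombE (A : set I) (c : free_module K I) : finite_set A ->
  supp c `<=` A -> lincomb c = \sum_(i \in A) c i *: f i.
Proof.
move=> finA cA; apply: fsbig_widen => // i [_ /=] /negP; rewrite negbK.
by move=> /eqP ->; rewrite scale0r.
Qed.

Lemma lincomb_semilinear : semilinear lincomb.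
Proof.
split=> [a c|c d].
  rewrite (@lincombE (supp c) (a *: c)); last 2 first.
  - exact: coord_finite.
  - by move=> i; rewrite /supp /=; apply: contra_neq => ->; rewrite mulr0.
  rewrite /lincomb !fsbig_finite; try exact: coord_finite.
  by rewrite scaler_sumr; apply: eq_bigr => i _; rewrite scalerA.
have fU : finite_set (supp c `|` supp d).
  by rewrite finite_setU; split; exact: coord_finite.
rewrite !(lincombE fU) //; last first.
  move=> i; rewrite /supp /=; have [->|] := eqVneq (c i) 0; last by left.
  by rewrite add0r; right.
rewrite !fsbig_finite // -big_split /=.
by apply: eq_bigr => i _; rewrite scalerDl.
Qed.

HB.instance Definition _ :=
  GRing.isSemilinear.Build K (free_module K I) E _ lincomb lincomb_semilinear.
End LinearCombination.

Section TropicalBases.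
Variables (K : comNzSemiRingType).
Implicit Types U V E : lSemiModType K.

Definition singular U V (f : {linear U -> V}) (u : U) : Prop :=
  exists f1 f2 : {linear U -> V}, orth_decomp f f1 f2 /\ f1 u = f2 u.

Definition Tker U V (f : {linear U -> V}) : set U := [set u | singular f u].

Definition regular U V (f : {linear U -> V}) : Prop := Tker f = [set 0].

Definition star_singular U V (f : {linear U -> V}) (u : U) : Prop :=
  exists u1 u2 : U, orth_decomp u u1 u2 /\ f u1 = f u2.

Definition Ker_star U V (f : {linear U -> V}) : set U :=
  [set u | star_singular f u].

Definition is_submodule E (F : set E) : Prop :=
  [/\ F 0, forall x y : E, F x -> F y -> F (x + y)
    & forall (a : K) (x : E), F x -> F (a *: x)].

Definition regular_family (I : choiceType) E (f : I -> E) : Prop :=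
  regular (lincomb f : {linear free_module K I -> E}).

(* [range (lincomb f)] is the submodule \sum_i K f_i, and the linear forms are
   the elements of L(E, K). *)
Definition weak_span (I : choiceType) E (f : I -> E) : set E :=
  \bigcap_(l in [set l : {linear E -> K^o} |
                   range (lincomb f) `<=` Ker_star l]) Ker_star l.

Definition weakly_generating (I : choiceType) E (f : I -> E) (F : set E) :=
  F = weak_span f.

Definition tropical_basis (I : choiceType) E (f : I -> E) (F : set E) : Prop :=
  regular_family f /\ weakly_generating f F.

Definition tropically_free E (F : set E) : Prop :=
  exists (I : choiceType) (f : I -> E), tropical_basis f F.
End TropicalBases.

(* Main.v *)
(* Choose coordinates on E.  A linear form l satisfies Ker_star l u iff the
   maximum of the products l_j u_j is 0 or attained at least twice, and a family
   f is regular iff for no nonzero x this holds, for every j, for the products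
   x_i f_i,j.  Two tropical bases f, g of F are orthogonal to the
   same forms l, so it suffices to show: if f has r independent members and every
   form orthogonal to g is orthogonal to f, then g has at least r members.
   Suppose g has fewer.  A tropical linear system with more unknowns than
   equations has a nonzero solution (Cramer's rule with permanents), so for each
   set S of r coordinates some nonzero form supported in S is orthogonal to g,
   hence to f.  Thus the columns of the r x r matrix f restricted to S are
   dependent, its permanent is attained twice or 0, and so its rows are dependent
   too.  By a Helly argument, a dependence of the rows of f on every r coordinates
   yields a dependence on all coordinates, contradicting regularity. *)
From HB Require Import structures.
Require Import Defs.
From mathcomp Require Import all_boot all_fingroup all_algebra.
From mathcomp Require Import boolp.

Set Implicit Arguments.
Unset Strict Implicit.
Unset Printing Implicit Defensive.

Import GRing.Theory.

Local Open Scope ring_scope.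

(** * Tropical linear systems *)

Section Order.
Variables (K : comNzSemiRingType).
Hypotheses (hK : idempotent_semifield K) (hKtot : totally_ordered K).
Implicit Types a b c d : K.

Lemma sle_refl a : sle a a.
Proof. by rewrite /sle (semifield_idem hK). Qed.

Lemma sle_trans a b c : sle a b -> sle b c -> sle a c.
Proof. by rewrite /sle => ab bc; rewrite -bc addrA ab. Qed.

Lemma sle0x a : sle 0 a.
Proof. by rewrite /sle add0r. Qed.

Lemma slex0 a : sle a 0 -> a = 0.
Proof. by rewrite /sle addr0. Qed.

Lemma sle_neq0 a b : sle a b -> a != 0 -> b != 0.
Proof. by move=> ab; apply: contra_neq => b0; apply: slex0; rewrite -b0. Qed.

Lemma sle_addl a b : sle a (a + b).
Proof. by rewrite /sle addrA (semifield_idem hK). Qed.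

Lemma sle_addr a b : sle b (a + b).
Proof. by rewrite addrC; exact: sle_addl. Qed.

Lemma sle_addP a b c : sle a c -> sle b c -> sle (a + b) c.
Proof. by rewrite /sle => ac bc; rewrite -addrA bc. Qed.

Lemma sle_mul a b c d : sle a b -> sle c d -> sle (a * c) (b * d).
Proof.
move=> ab cd; apply: (@sle_trans _ (b * c)).
  by rewrite /sle -mulrDl ab.
by rewrite /sle -mulrDr cd.
Qed.

Lemma smulf_neq0 a b : a != 0 -> b != 0 -> a * b != 0.
Proof.
move=> a0; apply: contra_neq => ab0; have [c ac] := semifield_inv hK a0.
by rewrite -[b]mul1r -ac mulrAC ab0 mul0r.
Qed.

Lemma smulf_neq0P a b : a * b != 0 -> a != 0 /\ b != 0.
Proof.
by move=> ab0; split; apply: contra_neq ab0 => ->; rewrite ?mul0r ?mulr0.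
Qed.

Lemma sprod_neq0 (T : finType) (P : pred T) (x : T -> K) :
  (forall t, P t -> x t != 0) -> \prod_(t | P t) x t != 0.
Proof.
move=> x0; apply: (big_ind (fun y => y != 0)) => //; first exact: oner_neq0.
exact: smulf_neq0.
Qed.

Lemma sle_mul2l c a b : c != 0 -> sle (c * a) (c * b) -> sle a b.
Proof.
move=> /(semifield_inv hK)[d cd] /(sle_mul (sle_refl d)).
by rewrite !mulrA ![d * c]mulrC cd !mul1r.
Qed.

Lemma sle_prod (T : finType) (P : pred T) (x y : T -> K) :
  (forall t, P t -> sle (x t) (y t)) ->
  sle (\prod_(t | P t) x t) (\prod_(t | P t) y t).
Proof.
move=> xy; apply: (big_ind2 (fun a b => sle a b)) => //; first exact: sle_refl.
by move=> a b c d; exact: sle_mul.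
Qed.

Lemma sle_sum (T : finType) (P : pred T) (x : T -> K) t :
  P t -> sle (x t) (\sum_(s | P s) x s).
Proof. by move=> Pt; rewrite (bigD1 t) //=; exact: sle_addl. Qed.

Lemma sum_attained (T : finType) (P : pred T) (x : T -> K) :
  \sum_(t | P t) x t != 0 -> exists2 t, P t & \sum_(s | P s) x s = x t.
Proof.
apply: (big_ind (fun y => y != 0 -> exists2 t, P t & y = x t)).
- by rewrite eqxx.
- move=> a b IHa IHb; case: (hKtot a b) => ab.
    by rewrite ab; exact: IHb.
  by rewrite addrC ab; exact: IHa.
- by move=> t Pt _; exists t.
Qed.

(* The maximum of [x] is 0 or attained at least twice. *)
Definition vanishes (T : Type) (x : T -> K) : Prop :=
  forall t, x t != 0 -> exists2 s, s <> t & sle (x t) (x s).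

Lemma vanishes_eq (T : Type) (x y : T -> K) :
  x =1 y -> vanishes x -> vanishes y.
Proof. by move=> /funext ->. Qed.

Lemma vanishesD (T : Type) (x y : T -> K) :
  vanishes x -> vanishes y -> vanishes (fun t => x t + y t).
Proof.
(* At [t] one of the two families dominates, and its second index serves the sum. *)
wlog suff W : x y / forall t, sle (y t) (x t) -> vanishes x ->
    x t + y t != 0 -> exists2 s, s <> t & sle (x t + y t) (x s + y s).
  move=> vx vy t xy0; case: (hKtot (y t) (x t)) => le_t; first exact: W.
  case: (W y x t) => //; first by rewrite addrC.
  by move=> s st ys; exists s => //; rewrite ![x _ + _]addrC.
move=> t yx vx; rewrite addrC yx => xt0; have [s st xs] := vx t xt0.
by exists s => //; apply: sle_trans xs (sle_addl _ _).
Qed.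

Lemma vanishesZ (T : Type) c (x : T -> K) :
  vanishes x -> vanishes (fun t => c * x t).
Proof.
move=> vx t /smulf_neq0P[_ /vx[s st xs]]; exists s => //.
exact: sle_mul (sle_refl _) xs.
Qed.

Lemma vanishes0 (T : Type) : vanishes (fun _ : T => 0 : K).
Proof. by move=> t; rewrite eqxx. Qed.

Lemma vanishes_sum (S T : Type) (r : seq S) (P : pred S) (x : S -> T -> K) :
  (forall s, P s -> vanishes (x s)) ->
  vanishes (fun t => \sum_(s <- r | P s) x s t).
Proof.
move=> vx; elim: r => [|s r IH].
  by apply: vanishes_eq (@vanishes0 T) => t; rewrite big_nil.
case Ps: (P s); last by apply: vanishes_eq IH => t; rewrite big_cons Ps.
by apply: vanishes_eq (vanishesD (vx s Ps) IH) => t; rewrite big_cons Ps.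
Qed.

(** The term at [t] is bounded by another term, so dropping it keeps the maximum. *)
Lemma vanishes_sumD1 (T : finType) (x : T -> K) t :
  vanishes x -> \sum_s x s = \sum_(s | s != t) x s.
Proof.
move=> vx; rewrite (bigD1 t) //=; have [->|xt0] := eqVneq (x t) 0.
  by rewrite add0r.
have [s /eqP st xts] := vx t xt0.
by apply: (sle_trans xts); exact: sle_sum.
Qed.

(* The cofactors of row [k] are permanents.  When they are all 0, counting only
   the permutations that meet the fewest zero entries, with those entries
   replaced by 1, still produces a nonzero solution. *)
Section Cofactors.
Variables (T : finType) (A : T -> T -> K) (k : T).
Implicit Types s : {perm T}.

Let nonz a := if a == 0 then 1 else a.

Definition nzeros s : nat := (\sum_(a | a != k) (A a (s a) == 0%R))%N.
Definition weight s : K := \prod_(a | a != k) nonz (A a (s a)).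

Definition min_nzeros : nat := nzeros [arg min_(s < 1%g) nzeros s].

Lemma min_nzeros_le s : (min_nzeros <= nzeros s)%N.
Proof. by rewrite /min_nzeros; case: arg_minnP => // ? _; apply. Qed.

Definition cofactor t : K :=
  \sum_(s : {perm T} | (s k == t) && (nzeros s == min_nzeros)) weight s.

Lemma weight_neq0 s : weight s != 0.
Proof.
apply: sprod_neq0 => a _; rewrite /nonz; case: ifPn => // _; exact: oner_neq0.
Qed.

Lemma weightE s : nzeros s = 0%N -> weight s = \prod_(a | a != k) A a (s a).
Proof.
move=> /eqP; rewrite sum_nat_eq0 => /forallP s0; apply: eq_bigr => a ak.
by have := s0 a; rewrite ak /= eqb0 /nonz => /negPf ->.
Qed.

Lemma cofactor_attained t : cofactor t != 0 ->
  exists s, [/\ s k = t, nzeros s = min_nzeros & cofactor t = weight s].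
Proof. by case/sum_attained=> s /andP[/eqP sk /eqP sz] e; exists s. Qed.

Lemma cofactor_ge s : nzeros s = min_nzeros -> sle (weight s) (cofactor (s k)).
Proof. by move=> sz; apply: sle_sum; rewrite sz !eqxx. Qed.

Lemma cofactor_neq0 : exists t, cofactor t != 0.
Proof.
exists ([arg min_(s < 1%g) nzeros s]%g k).
by apply: sle_neq0 (weight_neq0 _); exact: cofactor_ge.
Qed.

Lemma cofactor_row (a : T) : a != k -> vanishes (fun t => cofactor t * A a t).
Proof.
move=> ak t /smulf_neq0P[ct0 Aat0].
have [s [sk sz ->]] := cofactor_attained ct0.
(* if [s] realises the term of index [s k] in row [a], exchanging the values of
   [s] at [a] and [k] realises an equal term of index [s a] *)
pose s' := (tperm a k * s)%g.
have s'a : s' a = t by rewrite permM tpermL.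
have s'k : s' k = s a by rewrite permM tpermR.
have s'b (b : T) : (b != k) && (b != a) -> s' b = s b.
  by case/andP=> bk ba; rewrite permM tpermD // eq_sym.
have zs : nzeros s = ((A a (s a) == 0%R) +
    \sum_(b | (b != k) && (b != a)) (A b (s b) == 0%R))%N.
  by rewrite /nzeros (bigD1 a).
have zs' : nzeros s' = (\sum_(b | (b != k) && (b != a)) (A b (s b) == 0%R))%N.
  rewrite /nzeros (bigD1 a) //= s'a (negPf Aat0) add0n.
  by apply: eq_bigr => b /s'b ->.
(* A zero here would let [s'] meet one zero fewer than the minimum. *)
have Asa0 : A a (s a) != 0.
  apply/negP => Asa; have := min_nzeros_le s'.
  by rewrite -sz zs zs' Asa ltnn.
have s'z : nzeros s' = min_nzeros by rewrite zs' -sz zs (negPf Asa0).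
exists (s a); first by rewrite -sk => /perm_inj /eqP; rewrite (negPf ak).
rewrite -s'k; apply: (@sle_trans _ (weight s' * A a (s' k))); last first.
  by apply: sle_mul (sle_refl _); exact: cofactor_ge.
pose rest := \prod_(b | (b != k) && (b != a)) nonz (A b (s b)).
have -> : weight s = A a (s a) * rest.
  by rewrite /weight (bigD1 a) //= {1}/nonz (negPf Asa0).
have -> : weight s' = A a t * rest.
  rewrite /weight (bigD1 a) //= s'a {1}/nonz (negPf Aat0); congr (_ * _).
  by apply: eq_bigr => b /s'b ->.
by rewrite s'k [in X in sle X]mulrAC [A a (s a) * _]mulrC [in X in sle X]mulrAC;
  exact: sle_refl.
Qed.

End Cofactors.

(** * Systems with more unknowns than equations *)

(** Placing the equations in rows other than [k] and padding with zero rows gives a square matrix;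
    the cofactors of row [k] solve it. *)
Lemma wide_kernel (R T : finType) (A : R -> T -> K) : (#|R| < #|T|)%N ->
  exists2 x : T -> K, exists t, x t != 0
    & forall r, vanishes (fun t => x t * A r t).
Proof.
move=> RT; have T0 : (0 < #|T|)%N by exact: leq_trans RT.
pose k : T := enum_val (Ordinal T0).
(* Ranks are shifted by one to keep rank 0, that of [k], free. *)
have lt_r (r : R) : ((enum_rank r).+1 < #|T|)%N.
  by apply: leq_trans RT; rewrite ltnS.
pose h (r : R) : T := enum_val (Ordinal (lt_r r)).
have hk r : h r != k by rewrite (inj_eq enum_val_inj) -val_eqE.
have hI : injective h.
  by move=> r r' /enum_val_inj/(congr1 val)/= [] /val_inj/enum_rank_inj.
pose A' (a t : T) : K := if [pick r | h r == a] is Some r then A r t else 0.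
exists (cofactor A' k) => [|r]; first exact: cofactor_neq0.
have := @cofactor_row _ A' k (h r) (hk r); rewrite /A'.
by case: pickP => [r' /eqP/hI -> //|/(_ r)]; rewrite eqxx.
Qed.

Lemma wide_kernel_on (R T : finType) (S : {set T}) (A : R -> T -> K) :
  (#|R| < #|S|)%N ->
  exists x : T -> K, [/\ exists t, x t != 0, forall t, x t != 0 -> t \in S
    & forall r, vanishes (fun t => x t * A r t)].
Proof.
move=> RS; (* additional equations [x t = 0] for [t] outside [S] *)
pose B (r : R + {t | t \notin S}) t : K :=
  match r with inl r => A r t | inr u => (t == val u)%:R end.
have [|x x0 xB] := @wide_kernel (R + {t | t \notin S})%type T B.
  rewrite card_sum card_sig -(cardC (mem S)).
  rewrite (_ : #|[pred t | t \notin S]| = #|[predC S]|) ?ltn_add2r //.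
exists x; split=> // [t xt0|r]; last exact: (xB (inl r)).
apply/negPn/negP => tS; have := xB (inr (exist _ t tS)) t.
rewrite /B /= eqxx mulr1 => /(_ xt0)[s /eqP/negPf ->].
by rewrite mulr0 => /slex0/eqP; rewrite (negPf xt0).
Qed.

(** * Square systems *)

(** A minimal nonempty set mapped into itself by [phi] works: its image is again such a set. *)
Lemma exists_stable (T : finType) (U : {set T}) (phi : T -> T) :
  U != set0 -> (forall t, t \in U -> phi t \in U) ->
  exists P : {set T}, [/\ P \subset U, P != set0 & phi @: P = P].
Proof.
move=> U0 Uphi; pose stable := [pred P : {set T} | (P != set0)
  && (phi @: P \subset P)].
have [|P /minsetP[/andP[P0 Pst] Pmin] PU] := @minset_exists _ stable U.
  by rewrite inE U0; apply/subsetP => _ /imsetP[t tU ->]; exact: Uphi.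
exists P; split=> //; apply: Pmin => //=; rewrite imset_eq0 P0.
exact: imsetS.
Qed.

(* Row by row, [u] provides a second maximal term; this defines a map [phi]
   without fixed points.  Modifying [s] along [phi] on a set permuted by [phi]
   does not decrease the product, because the values of [u] cancel there. *)
Lemma tie_of_kernel (T : finType) (B : T -> T -> K) (u : T -> K)
    (s : {perm T}) :
  (forall t, B t (s t) != 0) ->
  (exists t, u t != 0) -> (forall a : T, vanishes (fun t => u t * B t a)) ->
  exists2 s' : {perm T}, s' != s
    & sle (\prod_t B t (s t)) (\prod_t B t (s' t)).
Proof.
move=> s0 [t0 ut0] uB.
have /choice[phi phiP] t : exists t', u t != 0 -> t' != t /\
    sle (u t * B t (s t)) (u t' * B t' (s t)).
  have [->|ut] := eqVneq (u t) 0; first by exists t.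
  have [t' t't le_t] := uB (s t) t (smulf_neq0 ut (s0 t)).
  by exists t' => _; split => //; exact/eqP.
have [||P [/subsetP PU P0 phiPE]] := @exists_stable _ [set t | u t != 0] phi.
- by apply/set0Pn; exists t0; rewrite inE.
- move=> t; rewrite !inE => ut; have [_ le_t] := phiP t ut.
  by case: (smulf_neq0P (sle_neq0 le_t (smulf_neq0 ut (s0 t)))).
have phiI : {in P &, injective phi} by apply/imset_injP; rewrite phiPE.
have phi_in t : t \in P -> phi t \in P by move=> tP; rewrite -phiPE imset_f.
(* [phi] permutes [P] without fixed points; the identity extends it to a permutation of [T]. *)
pose psi t := if t \in P then phi t else t.
have psiI : injective psi.
  move=> x y; rewrite /psi; case: ifPn => xP; case: ifPn => yP.
  - exact: phiI.
  - by move=> e; move: yP; rewrite -e phi_in.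
  - by move=> e; move: xP; rewrite e phi_in.
  - by [].
pose c := perm psiI; exists (c^-1 * s)%g.
  have [t tP] := set0Pn _ P0; have := PU t tP; rewrite inE => ut.
  have [phit _] := phiP t ut; apply: contra_neq phit => /permP/(_ (phi t)).
  rewrite permM (_ : c^-1%g (phi t) = t); last first.
    by apply: (@perm_inj _ c); rewrite permKV permE /psi tP.
  by move=> /perm_inj <-.
(* The product of [v] is nonzero and invariant under [c]; once it is multiplied in, the choice of
   [phi] compares both sides factor by factor. *)
pose v t := if t \in P then u t else 1.
have v0 : \prod_t v t != 0.
  apply: sprod_neq0 => t _; rewrite /v; case: ifP => [/PU|_].
    by rewrite inE.
  exact: oner_neq0.
apply: (sle_mul2l v0); rewrite -big_split /=.
rewrite [X in sle _ (_ * X)](reindex_inj (@perm_inj _ c)) /=.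
rewrite [X in sle _ (X * _)](reindex_inj (@perm_inj _ c)) /=.
rewrite -big_split /=; apply: sle_prod => t _; rewrite permM permK /v permE /psi.
have [tP|tP] := boolP (t \in P); last by rewrite (negPf tP); exact: sle_refl.
by rewrite phi_in //; have := PU t tP; rewrite inE => /phiP[].
Qed.

(** The cofactors of row [k] solve every other row, so it remains to choose [k] such that row [k]
    vanishes too. *)
Lemma square_kernel (T : finType) (B : T -> T -> K) (u : T -> K) :
  (exists t, u t != 0) -> (forall a : T, vanishes (fun t => u t * B t a)) ->
  exists2 v : T -> K, exists t, v t != 0
    & forall t, vanishes (fun a : T => v a * B t a).
Proof.
move=> u0 uB.
suff [k vk] : exists k, vanishes (fun a : T => cofactor B k a * B k a).
  exists (cofactor B k) => [|t]; first exact: cofactor_neq0.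
  by have [->//|tk] := eqVneq t k; exact: cofactor_row.
have [s0 full0|nofull] := pickP (fun s : {perm T} => [forall t, B t (s t) != 0]).
(* Nonzero permanent: its maximum is attained at [s1] and, by the dependence [u], at some [s2]. If
   they differ at [k], the expansion along row [k] is maximal at the two columns [s1 k] and
   [s2 k]. *)
- pose p (s : {perm T}) := \prod_t B t (s t).
  have p_full s t : p s != 0 -> B t (s t) != 0.
    by rewrite /p (bigD1 t) //= => /smulf_neq0P[].
  have p0 : \sum_s p s != 0.
    apply: sle_neq0 (sle_sum p (erefl (xpredT s0))) _.
    by apply: sprod_neq0 => t _; exact: (forallP full0 t).
  have [s1 _ s1E] := sum_attained p0.
  have s1_max s : sle (p s) (p s1) by rewrite -s1E; exact: sle_sum.
  have ps1 : p s1 != 0 by rewrite -s1E.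
  have [|s2 s21 le12] := tie_of_kernel _ u0 uB (s := s1).
    by move=> t; exact: p_full.
  have ps2 : p s2 != 0 := sle_neq0 le12 ps1.
  have [k s21k] : exists k, s2 k != s1 k.
    apply/existsP; apply: contraNT s21 => /existsPn e; apply/eqP/permP => t.
    by apply/eqP; have := e t; rewrite negbK.
  have nz_full s : p s != 0 -> nzeros B k s = 0%N.
    move=> ps; apply/eqP; rewrite sum_nat_eq0; apply/forallP => t.
    by rewrite eqb0 p_full // implybT.
  have min0 : min_nzeros B k = 0%N.
    by apply/eqP; rewrite -leqn0 -(nz_full s1 ps1); exact: min_nzeros_le.
  have pE s : nzeros B k s = 0%N -> p s = weight B k s * B k (s k).
    by move=> /weightE ->; rewrite mulrC /p (bigD1 k).
  have cof_le t : sle (cofactor B k t * B k t) (p s1).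
    have [->|/cofactor_attained[s [<- sz ->]]] := eqVneq (cofactor B k t) 0.
      by rewrite mul0r; exact: sle0x.
    by rewrite -pE ?sz.
  have cof_ge s : p s != 0 -> sle (p s) (cofactor B k (s k) * B k (s k)).
    move=> /nz_full sz; rewrite pE //; apply: sle_mul (sle_refl _).
    by apply: cofactor_ge; rewrite sz.
  exists k => t _; have [->|/eqP ts1] := eqVneq t (s1 k).
    exists (s2 k); first exact/eqP.
    by apply: sle_trans (cof_le _) _; apply: sle_trans le12 _; exact: cof_ge.
  exists (s1 k); first by move=> e; apply: ts1.
  by apply: sle_trans (cof_le _) _; exact: cof_ge.
(* Zero permanent: let [s0] meet the fewest zeros, one of them in row [k]. A nonzero term in the
   expansion along row [k] would yield a permutation with fewer zeros. *)
- pose z (s : {perm T}) := (\sum_t (B t (s t) == 0%R))%N.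
  pose s0 := [arg min_(s < 1%g) z s]%g.
  have s0_min s : (z s0 <= z s)%N by rewrite /s0; case: arg_minnP => // ? _; apply.
  have := nofull s0 => /negbT/forallPn[k]; rewrite negbK => Bk0.
  exists k => t /smulf_neq0P[/cofactor_attained[s [sk sz _]] Bkt].
  have : (z s < z s0)%N.
    rewrite /z (bigD1 k) //= [X in (_ < X)%N](bigD1 k) //= Bk0 sk (negPf Bkt).
    by rewrite add0n add1n ltnS -!/(nzeros B k _) sz min_nzeros_le.
  by rewrite ltnNge s0_min.
Qed.

(* [x := \sum_i c i *: p i] vanishes on column [j] because the tropical
   dependence of the [p i] gives [x = \sum_(i != j) c i *: p i]. *)
Lemma helly_kernel (X J : finType) (M : X -> J -> K) :
  (forall S : {set J}, (#|S| <= #|X|)%N -> exists2 x : X -> K,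
     exists a : X, x a != 0 & forall j, j \in S -> vanishes (fun a : X => x a * M a j)) ->
  exists2 x : X -> K,
    exists a : X, x a != 0 & forall j, vanishes (fun a : X => x a * M a j).
Proof.
move=> small.
suff all_S (S : {set J}) : exists2 x : X -> K, exists a : X, x a != 0
    & forall j, j \in S -> vanishes (fun a : X => x a * M a j).
  have [x x0 xM] := all_S setT; exists x => // j; exact: xM.
have [m] := ubnP #|S|; elim: m S => // m IH S; rewrite ltnS => Sm.
have [/small//|XS] := leqP #|S| #|X|.
have /choice[p pP] j : exists x : X -> K, j \in S -> (exists a : X, x a != 0) /\
    forall i, i \in S -> i != j -> vanishes (fun a : X => x a * M a i).
  have [jS|_] := boolP (j \in S); last by exists (fun=> 0).
  have [|x x0 xM] := IH (S :\ j).
    by apply: leq_trans Sm; rewrite [X in (_ < X)%N](cardsD1 j) jS.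
  by exists x => _; split=> // i iS ij; apply: xM; rewrite in_setD1 ij.
(* There are [#|S|] vectors [p j] with only [#|X|] coordinates, hence a dependence [c]. *)
have [c [[j0 cj0] cS cp]] := @wide_kernel_on X J S (fun (a : X) j => p j a) XS.
exists (fun a : X => \sum_j c j * p j a).
  have [[a pa0] _] := pP j0 (cS j0 cj0); exists a.
  exact: sle_neq0 (sle_sum (fun j => c j * p j a) (erefl (xpredT j0)))
    (smulf_neq0 cj0 pa0).
move=> j jS; pose y (a : X) := \sum_(i | i != j) c i * (p i a * M a j).
apply: (@vanishes_eq _ y) => [a|].
  rewrite (vanishes_sumD1 j (cp a)) mulr_suml.
  by apply: eq_bigr => i _; rewrite mulrA.
apply: vanishes_sum => i ij; have [->|ci] := eqVneq (c i) 0.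
  by apply: vanishes_eq (@vanishes0 X) => a; rewrite mul0r.
apply: vanishesZ; have [_] := pP i (cS i ci); apply => //.
by rewrite eq_sym.
Qed.

Lemma independent_rows_le (X Y J : finType) (M : X -> J -> K) (G : Y -> J -> K) :
  (forall x : X -> K, (forall j, vanishes (fun a : X => x a * M a j)) ->
     forall a : X, x a = 0) ->
  (forall l : J -> K, (forall b : Y, vanishes (fun j => l j * G b j)) ->
     forall a : X, vanishes (fun j => l j * M a j)) ->
  (#|X| <= #|Y|)%N.
Proof.
move=> indep ortho; rewrite leqNgt; apply/negP => YX.
suff [x [a xa] xM] : exists2 x : X -> K, exists a : X, x a != 0
    & forall j, vanishes (fun a : X => x a * M a j).
  by move/eqP: xa; apply; exact: indep.
apply: helly_kernel => S; rewrite leq_eqVlt => /orP[/eqP SX|SX].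
  have [l [[j0 lj0] lS lG]] := @wide_kernel_on Y J S G (leq_trans YX (eq_leq (esym SX))).
  have lM := ortho l lG.
  pose h (a : X) : J := enum_val (cast_ord (esym SX) (enum_rank a)).
  have hI : injective h by move=> a b /enum_val_inj/cast_ord_inj/enum_rank_inj.
  have hS j : j \in S -> exists a : X, h a = j.
    move=> jS; exists (enum_val (cast_ord SX (enum_rank_in jS j))).
    by rewrite /h enum_valK cast_ordK enum_rankK_in.
  have [||x x0 xM] := @square_kernel X (fun b a : X => M a (h b)) (l \o h).
  - by have [a ha] := hS j0 (lS j0 lj0); exists a; rewrite /= ha.
  (* The second maximal index lies in [S], because [l] is zero elsewhere. *)
  - move=> a b lhM; have [j /eqP jh le_j] := lM a _ lhM.
    have [lj _] := smulf_neq0P (sle_neq0 le_j lhM).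
    have [b' hb'] := hS j (lS j lj); exists b'; last by rewrite /= hb'.
    by move=> e; move: jh; rewrite -hb' e eqxx.
  by exists x => // j /hS[b <-]; exact: xM.
(* With fewer than [#|X|] columns there are already fewer equations than unknowns. *)
have [|x x0 xM] := @wide_kernel 'I_#|S| X (fun (b : 'I_#|S|) (a : X) => M a (enum_val b)).
  by rewrite card_ord.
exists x => // j jS; have := xM (enum_rank_in jS j).
by rewrite enum_rankK_in.
Qed.
End Order.

(* Imported only now, because classical_sets redefines the notations of finset. *)
From mathcomp Require Import classical_sets functions cardinality fsbigop.
From mathcomp Require Import finmap.

Import VectorInternalTheory.
Local Open Scope classical_set_scope.

(** * Coordinates *)

Section FreeModuleBasis.
Variables (K : comNzSemiRingType) (I : choiceType).

Lemma fm_delta_finite (i : I) : finite_set (supp (fun k : I => (k == i)%:R : K)).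
Proof.
apply: sub_finite_set (finite_set1 i) => k; rewrite /supp /=.
by have [->|_] := eqVneq k i; rewrite ?eqxx.
Qed.

Definition fm_delta (i : I) : free_module K I := FreeModule (fm_delta_finite i).

Lemma lincomb_delta (E : lSemiModType K) (f : I -> E) i :
  lincomb f (fm_delta i) = f i.
Proof.
rewrite (@lincombE _ _ _ _ [set i]); first by rewrite fsbig_set1 /= eqxx scale1r.
  exact: finite_set1.
by move=> k; rewrite /supp /=; have [->|_] := eqVneq k i; rewrite ?eqxx.
Qed.

Lemma coord_sum (S : Type) (r : seq S) (P : pred S) (c : S -> free_module K I) i :
  (\sum_(s <- r | P s) c s : free_module K I) i = \sum_(s <- r | P s) c s i.
Proof. exact: (big_morph (fun d : free_module K I => d i)). Qed.

Lemma lincomb_deltaE (c : free_module K I) : lincomb fm_delta c = c.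
Proof.
apply: free_module_ext => i; rewrite /lincomb fsbig_finite; last exact: coord_finite.
rewrite coord_sum /=; have [ci0|ci] := eqVneq (c i) 0.
  rewrite big1 ?ci0 // => k _; have [<-|_] := eqVneq i k; first by rewrite ci0 mul0r.
  by rewrite mulr0.
rewrite (bigD1_seq i) ?fset_uniq //=; last first.
  by rewrite in_fset_set; [exact: mem_set | exact: coord_finite].
rewrite eqxx mulr1 big1 ?addr0 // => k /negPf ki.
by rewrite eq_sym ki mulr0.
Qed.

Lemma linear_fm_delta0 (E : lSemiModType K) (z : {linear free_module K I -> E}) :
  (forall i, z (fm_delta i) = 0) -> z = 0.
Proof.
move=> z0; apply: linear_ext => c; rewrite -[c]lincomb_deltaE /lincomb.
rewrite fsbig_finite; last exact: coord_finite.
by rewrite linear_sum big1 //= => i _; rewrite linearZ /= z0 scaler0.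
Qed.
End FreeModuleBasis.

Section LincombFamily.
Variables (K : comNzSemiRingType) (I : choiceType) (E : lSemiModType K).

Lemma lincomb_family_add (f f1 f2 : I -> E) :
  (forall i, f i = f1 i + f2 i) ->
  lincomb f = lincomb f1 + lincomb f2 :> {linear free_module K I -> E}.
Proof.
move=> fE; apply: linear_ext => c /=; rewrite /lincomb.
rewrite !fsbig_finite; try exact: coord_finite.
by rewrite -big_split; apply: eq_bigr => i _; rewrite fE scalerDr.
Qed.
End LincombFamily.

(** * Orthogonality and [Ker_star] in coordinates *)

Section Coordinates.
Variables (K : comNzSemiRingType).
Hypotheses (hK : idempotent_semifield K) (hKtot : totally_ordered K).
Variable E : semiVectType K.
Implicit Types (u v : E) (l : {linear E -> K^o}).

Definition crd u (j : 'I_(dim E)) : K := v2r u 0 j.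
Definition vec (c : 'I_(dim E) -> K) : E := r2v (\row_j c j).
Definition basis j : E := r2v (delta_mx 0 j).

Lemma crd_vec c j : crd (vec c) j = c j.
Proof. by rewrite /crd r2vK mxE. Qed.

Lemma crd_basis i j : crd (basis j) i = (i == j)%:R.
Proof. by rewrite /crd r2vK mxE eqxx. Qed.

Lemma crd_inj u v : crd u =1 crd v -> u = v.
Proof. by move=> uv; apply: v2r_inj; apply/rowP => j; exact: uv. Qed.

Lemma crdD u v j : crd (u + v) j = crd u j + crd v j.
Proof. by rewrite /crd linearD mxE. Qed.

Lemma crdZ c u j : crd (c *: u) j = c * crd u j.
Proof. by rewrite /crd linearZ mxE. Qed.

Lemma crd0 j : crd 0 j = 0.
Proof. by rewrite /crd linear0 mxE. Qed.

Lemma crd_sum (S : Type) (r : seq S) (P : pred S) (u : S -> E) j :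
  crd (\sum_(s <- r | P s) u s) j = \sum_(s <- r | P s) crd (u s) j.
Proof. by rewrite /crd linear_sum summxE. Qed.

Lemma form_crd l u : l u = \sum_j l (basis j) * crd u j.
Proof.
rewrite -{1}[u]v2rK [v2r u]row_sum_delta !linear_sum; apply: eq_bigr => j _.
by rewrite !linearZ /= mulrC.
Qed.

Definition form_of (c : 'I_(dim E) -> K) (u : E) : K^o := \sum_j c j * crd u j.

Lemma form_of_semilinear c : semilinear (form_of c).
Proof.
split=> [a u|u v]; rewrite /form_of.
  rewrite scaler_sumr; apply: eq_bigr => j _.
  by rewrite crdZ mulrCA.
by rewrite -big_split; apply: eq_bigr => j _; rewrite crdD mulrDr.
Qed.

HB.instance Definition _ c :=
  GRing.isSemilinear.Build K E K^o _ (form_of c) (form_of_semilinear c).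

Lemma form_of_basis c j : form_of c (basis j) = c j.
Proof.
rewrite /form_of (bigD1 j) //= crd_basis eqxx mulr1 big1 ?addr0 //.
by move=> i /negPf ij; rewrite crd_basis ij mulr0.
Qed.

(** Both vectors absorb the basis vector [basis j] scaled by the smaller of their [j]-th
    coordinates, so orthogonality makes that coordinate 0. *)
Lemma orthogonalP u v : Defs.orthogonal u v <-> forall j, crd u j = 0 \/ crd v j = 0.
Proof.
split=> [uv j|uv z uz vz]; last first.
  apply: crd_inj => j; rewrite crd0; have := congr1 (crd^~ j) uz.
  have := congr1 (crd^~ j) vz; rewrite !crdD.
  by case: (uv j) => ->; rewrite ?add0r.
wlog uv_le : u v uv / sle (crd u j) (crd v j).
  move=> W; case: (hKtot (crd u j) (crd v j)); first exact: W.
  by move=> vu; apply/or_comm; apply: W => // z vz uz; exact: uv.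
left; have le_add w : sle (crd u j) (crd w j) -> w + crd u j *: basis j = w.
  move=> uw; apply: crd_inj => i; rewrite crdD crdZ crd_basis.
  case: eqP => [->|_]; first by rewrite mulr1 addrC uw.
  by rewrite mulr0 addr0.
have /(congr1 (crd^~ j)) := uv _ (le_add u (sle_refl hK _)) (le_add v uv_le).
by rewrite crdZ crd0 crd_basis eqxx mulr1.
Qed.

(** A nonzero term at [j] comes from one part and is bounded by a term of the other part, which is 0
    at [j]. Conversely, when [l u] is nonzero, splitting off the coordinate [j0] of a maximal term
    leaves the value [l u] on both parts. *)
Lemma Ker_star_crd l u :
  Ker_star l u <-> vanishes (fun j => l (basis j) * crd u j).
Proof.
split=> [[u1 [u2 [[-> /orthogonalP u12] l12]]] j|].
- wlog : u1 u2 u12 l12 / crd u2 j = 0.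
    move=> W; case: (u12 j) => [u1j|]; last exact: W.
    rewrite [u1 + u2]addrC; apply: W (esym l12) u1j => i.
    by apply/or_comm.
  move=> u2j; rewrite crdD u2j addr0 => lu1.
  have le_l : sle (l (basis j) * crd u1 j) (l u2).
    by rewrite -l12 (form_crd l u1); exact: (sle_sum hK (fun i => l (basis i) * crd u1 i)).
  have := sle_neq0 le_l lu1; rewrite form_crd => /(sum_attained hKtot)[i _ iE].
  exists i.
    move=> ij; have := sle_neq0 le_l lu1.
    by rewrite form_crd iE ij u2j mulr0 eqxx.
  apply: (sle_trans le_l); rewrite form_crd iE crdD.
  by apply: (sle_mul (sle_refl hK _)); exact: sle_addr.
- move=> van; have [l0|] := eqVneq (\sum_j l (basis j) * crd u j) 0.
    exists u, 0; split; last by rewrite linear0 form_crd.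
    by split; [rewrite addr0 | apply/orthogonalP => j; right; exact: crd0].
  move=> /(sum_attained hKtot)[j0 _ j0E].
  exists (vec (fun j => if j == j0 then crd u j else 0)).
  exists (vec (fun j => if j == j0 then 0 else crd u j)); split; first split.
  + apply: crd_inj => j; rewrite crdD !crd_vec.
    by case: eqP => _; rewrite ?addr0 ?add0r.
  + by apply/orthogonalP => j; rewrite !crd_vec; case: eqP => _; [right|left].
  + rewrite [LHS]form_crd [RHS]form_crd; transitivity (l (basis j0) * crd u j0).
      rewrite (bigD1 j0) //= crd_vec eqxx big1 ?addr0 //.
      by move=> j /negPf jj0; rewrite crd_vec jj0 mulr0.
    rewrite -j0E (vanishes_sumD1 hK j0 van) [RHS](bigD1 j0) //= crd_vec eqxx mulr0.
    by rewrite add0r; apply: eq_bigr => j /negPf jj0; rewrite crd_vec jj0.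
Qed.

Lemma range_sub_Ker_star (I : choiceType) (f : I -> E) l :
  range (lincomb f) `<=` Ker_star l <->
  forall i, vanishes (fun j => l (basis j) * crd (f i) j).
Proof.
split=> [fl i|fl _ [c _ <-]].
  by apply/Ker_star_crd; apply: fl; exists (fm_delta K i) => //; rewrite lincomb_delta.
apply/Ker_star_crd; rewrite /lincomb fsbig_finite; last exact: coord_finite.
apply: (@vanishes_eq _ _ (fun j => \sum_(i <- fset_set (supp c))
    c i * (l (basis j) * crd (f i) j))) => [j|].
  by rewrite crd_sum mulr_sumr; apply: eq_bigr => i _; rewrite crdZ mulrCA.
by apply: (vanishes_sum hK hKtot) => i _; apply: vanishesZ => //; exact: fl.
Qed.

(** * Regular families *)

(** A dependence [x] gives a singular point [c] of [lincomb f]: the entries of [f] are shared out,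
    coordinate by coordinate, between two families with equal combinations. *)
Lemma regular_family_indep (I : choiceType) (f : I -> E) (X : finType)
    (h : X -> I) : injective h -> regular_family f ->
  forall x : X -> K, (forall j, vanishes (fun a => x a * crd (f (h a)) j)) ->
  forall a, x a = 0.
Proof.
move=> hI reg x van.
(* [P j] isolates one maximal term; the remaining ones reach the same maximum. If the sum is 0, any
   [P j] does. *)
have /choice[P PE] j : exists P : pred I,
    \sum_a x a * (if P (h a) then crd (f (h a)) j else 0) =
    \sum_a x a * (if P (h a) then 0 else crd (f (h a)) j).
  have [s0|] := eqVneq (\sum_a x a * crd (f (h a)) j) 0.
    by exists xpredT; rewrite s0 big1 // => a _; rewrite mulr0.
  move=> /(sum_attained hKtot)[a0 _ a0E]; exists (pred1 (h a0)).
  transitivity (x a0 * crd (f (h a0)) j).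
    rewrite (bigD1 a0) //= eqxx big1 ?addr0 // => a /negPf aa0.
    by rewrite (inj_eq hI) aa0 mulr0.
  rewrite -a0E (vanishes_sumD1 hK a0 (van j)) [RHS](bigD1 a0) //= eqxx mulr0.
  by rewrite add0r; apply: eq_bigr => a /negPf aa0; rewrite (inj_eq hI) aa0.
pose f1 i := vec (fun j => if P j i then crd (f i) j else 0).
pose f2 i := vec (fun j => if P j i then 0 else crd (f i) j).
pose c : free_module K I := \sum_a x a *: fm_delta K (h a).
have lincomb_c (k : I -> E) : lincomb k c = \sum_a x a *: k (h a).
  by rewrite linear_sum; apply: eq_bigr => a _; rewrite linearZ /= lincomb_delta.
have sing : Tker (lincomb f : {linear free_module K I -> E}) c.
  exists (lincomb f1), (lincomb f2); split; first split.
  - apply: lincomb_family_add => i; apply: crd_inj => j; rewrite crdD !crd_vec.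
    by case: ifP => _; rewrite ?addr0 ?add0r.
  - move=> z z1 z2; apply: linear_fm_delta0 => i.
    have orth : Defs.orthogonal (f1 i) (f2 i).
      by apply/orthogonalP => j; rewrite !crd_vec; case: ifP => _; [right|left].
    apply: orth.
    + have /(congr1 (fun k : {linear free_module K I -> E} => k (fm_delta K i))) := z1.
      by rewrite /= lincomb_delta.
    + have /(congr1 (fun k : {linear free_module K I -> E} => k (fm_delta K i))) := z2.
      by rewrite /= lincomb_delta.
  - rewrite [LHS]lincomb_c [RHS]lincomb_c; apply: crd_inj => j; rewrite !crd_sum.
    under eq_bigr do rewrite crdZ crd_vec.
    by under [RHS]eq_bigr do rewrite crdZ crd_vec.
have c0 : c = 0 by move: sing; rewrite reg.
move=> a; have /(congr1 (fun d : free_module K I => d (h a))) := c0.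
rewrite coord_sum (bigD1 a) //= eqxx mulr1 big1 ?addr0 // => b /negPf ba.
by rewrite (inj_eq hI) eq_sym ba mulr0.
Qed.

(** The comparison is with the canonical basis: only the zero form is orthogonal to all of it. *)
Lemma regular_family_card (I : choiceType) (f : I -> E) (X : finType)
    (h : X -> I) : injective h -> regular_family f -> (#|X| <= dim E)%N.
Proof.
move=> hI reg; rewrite -[X in (_ <= X)%N]card_ord.
apply: (@independent_rows_le _ hK hKtot X _ _ (fun a j => crd (f (h a)) j)
  (fun b j => (j == b)%:R)); first exact: regular_family_indep.
move=> l l0 a j; suff -> : l j = 0 by rewrite mul0r eqxx.
apply/eqP/negPn/negP => lj0; have := l0 j j.
rewrite eqxx mulr1 => /(_ lj0)[i /eqP/negPf ->].
by rewrite mulr0 => /slex0/eqP; rewrite (negPf lj0).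
Qed.

Lemma regular_family_finite (I : choiceType) (f : I -> E) :
  regular_family f -> finite_set [set: I].
Proof.
move=> reg; apply: contrapT => /(@infinite_set_fset _ _ (dim E).+1)[B _ cardB].
have := @regular_family_card I f B val val_inj reg.
by rewrite -cardfE leqNgt cardB.
Qed.

(** The range of [f] lies in its weak span, and [weak_span g] lies in [Ker_star l]. *)
Lemma weak_span_sub_Ker_star (I J : choiceType) (f : I -> E) (g : J -> E) l :
  weak_span f = weak_span g ->
  range (lincomb g) `<=` Ker_star l -> range (lincomb f) `<=` Ker_star l.
Proof.
move=> fg gl u fu; have : weak_span g u by rewrite -fg => k; exact.
exact.
Qed.

Lemma weak_span_card_le (I J : choiceType) (f : I -> E) (g : J -> E)
    (X Y : finType) (h : X -> I) (k : Y -> J) :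
  injective h -> (forall j, exists b, k b = j) -> regular_family f ->
  weak_span f = weak_span g -> (#|X| <= #|Y|)%N.
Proof.
move=> hI kS reg fg.
apply: (@independent_rows_le _ hK hKtot X Y _ (fun a j => crd (f (h a)) j)
  (fun b j => crd (g (k b)) j)); first exact: regular_family_indep.
move=> c cg a; pose l : {linear E -> K^o} := form_of c.
have lE (u : E) : (fun j => l (basis j) * crd u j) = (fun j => c j * crd u j).
  by apply: funext => j; congr (_ * _); exact: form_of_basis.
rewrite -lE; apply: (range_sub_Ker_star f l).1.
apply: (weak_span_sub_Ker_star fg); apply/range_sub_Ker_star => j.
by have [b <-] := kS j; rewrite lE; exact: cg.
Qed.
End Coordinates.

Theorem proposition11 (K : comNzSemiRingType)
    (hK : idempotent_semifield K) (hKtot : totally_ordered K)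
    (n : nat) (E : semiVectType K) (hE : dim E = n)
    (F : set E) (hF : is_submodule F) (hfree : tropically_free F)
    (I J : choiceType) (f : I -> E) (g : J -> E)
    (hf : tropical_basis f F) (hg : tropical_basis g F) :
  ([set: I] #= [set: J])%card.
Proof.
(* Regular families are finite, so ordinals enumerate both bases, and the cardinal bound is applied
   in each direction. *)
have enum_fin (T : choiceType) : finite_set [set: T] ->
    exists m, ([set: T] #= `I_m)%card /\
      exists h : 'I_m -> T, injective h /\ forall t, exists a, h a = t.
  move=> /finite_setP[m Tm]; exists m; split=> //.
  have /card_set_bijP[p [pm pI pS]] := Tm.
  have /choice[h hE'] (a : 'I_m) : exists t, p t = a.
    by have [t _ ta] := pS a (ltn_ord a); exists t.
  exists h; split=> [a b hab|t]; first by apply: val_inj; rewrite /= -!hE' hab.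
  by exists (Ordinal (pm t Logic.I)); apply: pI; [exact: mem_set|exact: mem_set|exact: hE'].
have [[freg fF] [greg gF]] := (hf, hg).
have fg : weak_span f = weak_span g by rewrite -fF.
have [r [Ir [h [hI hS]]]] := enum_fin I (regular_family_finite hK hKtot freg).
have [s [Js [k [kI kS]]]] := enum_fin J (regular_family_finite hK hKtot greg).
have le_rs := weak_span_card_le hK hKtot hI kS freg fg.
have le_sr := weak_span_card_le hK hKtot kI hS greg (esym fg).
rewrite !card_ord in le_rs le_sr.
have rs : r = s by apply/eqP; rewrite eqn_leq le_rs.
by apply: card_eq_trans Ir _; rewrite rs card_eq_sym.
Qed.
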